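(* (1) $\mathrm{mean}$-DHNs are at least as expressive as RHML. (2) On databases of bounded degree (i.e. for every $B\ge 0$, on databases of degree at most $B$), the following have the same expressive power: connected $\mathrm{mean}$-DHNs, connected simple $\mathrm{mean}$-DHNs, and connected RHML.
   Context: Databases. A schema $S$ is a finite set of relation symbols $R$ with arities $\mathrm{ar}(R)\ge 0$. An $S$-database $D$ is a finite set of facts $R(\bar v)$, $R\in S$, $\bar v$ an $\mathrm{ar}(R)$-tuple of values from a fixed countably infinite set; $\mathrm{adom}(D)$ is the set of values occurring in $D$. The degree of $D$ is the maximum number of facts that any value occurs in. A pointed database $D^v$ is a database with $v\in\mathrm{adom}(D)$. A pattern $F$ is a database together with a finite set $\mathrm{adom}(F)$ of values containing all values occurring in its facts (isolated values allowed); $F^w$ is a pattern with distinguished $w\in\mathrm{adom}(F)$. $\mathrm{Hom}(F^w,D^u)$ is the set of maps $h:\mathrm{adom}(F)\to\mathrm{adom}(D)$ with $h(w)=u$ and $R(\bar v)\in F\Rightarrow R(h(\bar v))\in D$. The Gaifman graph of $F$ has vertex set $\mathrm{adom}(F)$ and edges between distinct values occurring together in a fact. DHNs. An aggregation function maps finite multisets of reals to reals; mean is the arithmetic mean with $\mathrm{mean}(\emptyset)=0$; applied to vectors component-wise. A homomorphism query of input dimension $d\ge 0$ and output dimension $d'>0$ is a triple $(F^w,\mu,\mathrm{agg})$, $F^w$ a pointed pattern, $\mu$ assigning to each $v\in\mathrm{adom}(F)$ a transformation function $\mu_v:\mathbb R^d\to\mathbb R^{d'}$, $\mathrm{agg}$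 an aggregation function. On $D^u$ with embedding $\lambda:\mathrm{adom}(D)\to\mathbb R^d$ its result is $\mathrm{agg}\{\!\{\prod_{v\in\mathrm{adom}(F)}\mu_v(\lambda(h(v)))\mid h\in\mathrm{Hom}(F^w,D^u)\}\!\}$ (component-wise product). It is connected if the Gaifman graph of $F$ is connected. A DHN layer is a finite sequence of homomorphism queries of the same input dimension, with output dimensions $d_1,\dots,d_m$, and a combination function $\mathrm{com}:\mathbb R^{d_1}\times\dots\times\mathbb R^{d_m}\to\mathbb R^{d'}$; it maps $\lambda$ to the embedding sending $u$ to $\mathrm{com}$ applied to the results of the queries on $(D^u,\lambda)$. A DHN over $S$ is a sequence $(\mathcal L_1,\dots,\mathcal L_k,\mathrm{cls})$ of layers with matching dimensions, input dimension of $\mathcal L_1$ equal to $0$, and a classification function $\mathrm{cls}:\mathbb R^{d'}\to\{0,1\}$. Starting from the empty-vector embedding, apply the layers in order to get $\lambda^k$; the DHN accepts $D^v$ iff $\mathrm{cls}(\lambda^k(v))=1$. All these functions are arbitrary unless stated otherwise. A mean-DHN uses only the aggregation function mean; a DHN is connected if all its queries are. A DHN is simple if, with $\mathrm{ReLU}^*(x)=\min(\max(0,x),1)$ applied component-wise, every combination function has the form $\mathrm{ReLU}^*(\bar x_1A_1+\dots+\bar x_mA_m+\bar b)$, every transformation function the form $\mathrm{ReLU}^*(\bar xA+\bar b)$, with rational matrices and bias vectors, and $\mathrm{cls}(\bar x)=1$ iff $x_i\sim c$ for some fixed $i$, $c\in\mathbb Q$, ${\sim}\in\{>,\ge\}$.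 RHML. Formulas (one free variable): $\varphi(x)::=\neg\varphi(x)\mid\varphi(x)\vee\varphi(x)\mid\exists_{\ge t}\,\bar y\,(\mu(x,\bar y),\nu(x,\bar y))\mid\exists_{>t}\,\bar y\,(\mu(x,\bar y),\nu(x,\bar y))$, where $t\in\mathbb Q$, $\mu$ is a conjunction of RHML formulas $\varphi(z)$ with one free variable $z$ among $x,\bar y$, and $\nu$ is a conjunction of relational atoms $R(\bar z)$ over $x,\bar y$. With $n=|\bar y|$, $D\models\exists_{\ge t}\bar y(\mu,\nu)(v)$ iff $\frac{|\{\bar w\in\mathrm{adom}(D)^n: D\models\mu(v,\bar w)\wedge\nu(v,\bar w)\}|}{|\{\bar w\in\mathrm{adom}(D)^n: D\models\nu(v,\bar w)\}|}\ge t$, or the denominator is $0$; and $D\models\exists_{>t}\bar y(\mu,\nu)(v)$ iff the denominator is nonzero and the fraction is $>t$. An RHML formula is connected if for every subformula $\exists_{\sim t}\bar y(\mu,\nu)$ some atom of $\nu$ uses $x$ and the Gaifman graph formed by the atoms of $\nu$, with all of $x,\bar y$ as vertices, is connected. Expressive power. A classifier over $S$ expresses the set of pointed $S$-databases $D^v$ it accepts (a formula accepts $D^v$ iff $D\models\varphi(v)$). A class $\mathcal C_2$ is at least as expressive as $\mathcal C_1$ if every property expressible by a member of $\mathcal C_1$ is expressible by a member of $\mathcal C_2$; same expressive power means this holds in both directions. ''On databases of degree at most $B$'' means that only acceptance of pointed databases of degree at most $B$ is considered.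
   Formalization: In (2), the comparisons with connected RHML assume the schema has a relation symbol of positive arity; otherwise no connected RHML formula exists, while connected mean-DHNs do (expressing the empty property), so the equality literally fails. *)

(* Defs.v *)
(* Built on MathComp; the reals are an arbitrary [realType]. *)
From HB Require Import structures.
From mathcomp Require Import all_boot all_order all_algebra.
From mathcomp Require Import finmap multiset reals.

Set Implicit Arguments.
Unset Strict Implicit.
Unset Printing Implicit Defensive.

Import Order.TTheory GRing.Theory Num.Theory.

Local Open Scope fset_scope.
Local Open Scope mset_scope.
Local Open Scope nat_scope.
Local Open Scope ring_scope.

(** * Databases and patterns *)

Record schema := Schema { symbol :> finType; arity : symbol -> nat }.

(* [fact S V] serves three purposes: facts of a database ([V] the values),
   facts of a pattern ([V] its active domain) and atoms of a formula
   ([V] its variables). *)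
Definition fact (S : schema) (V : Type) : Type :=
  {r : S & (arity r).-tuple V}.

Definition args (S : schema) (V : Type) (f : fact S V) : seq V := tagged f.

Definition map_fact (S : schema) (V W : Type) (h : V -> W) (f : fact S V) :
    fact S W :=
  Tagged (fun r : S => (arity r).-tuple W) [tuple of map h (tagged f)].

Definition value : choiceType := nat.

Definition database (S : schema) := {fset fact S value}.

Definition adom (S : schema) (D : database S) : {fset value} :=
  \bigcup_(f <- D) [fset x in args f].

Definition degree (S : schema) (D : database S) : nat :=
  \max_(x : adom D) #|` [fset f in D | val x \in args f]|.

Record pointed_db (S : schema) :=
  PointedDb { db_of : database S; db_point : adom db_of }.

(* The facts of a pattern are facts over the subtype [pdom] itself, so [pdom]
   contains all the values that occur in them; it may contain further ones. *)
Record pattern (S : schema) :=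
  Pattern { pdom : {fset value}; pfacts : {fset fact S pdom} }.

Definition Homs (S : schema) (F : pattern S) (w : pdom F)
    (D : database S) (u : adom D) : {set {ffun pdom F -> adom D}} :=
  [set h : {ffun pdom F -> adom D} | (h w == u) &&
     all (fun f => map_fact (fun a => val (h a)) f \in D) (pfacts F)].

Definition gaifman (S : schema) (V : finType) (fs : seq (fact S V)) : rel V :=
  fun a b => (a != b) && has (fun f => (a \in args f) && (b \in args f)) fs.

Definition gaifman_connected (S : schema) (V : finType)
    (fs : seq (fact S V)) : bool :=
  [forall a, forall b, connect (gaifman fs) a b].

(** * Deep homomorphism networks *)

Section DHN.
Variables (R : realType) (S : schema).

(* Division by zero is zero, hence the mean of the empty multiset is 0. *)
Definition mean (m : {mset R}) : R := (\sum_(x <- m) x) / (size m)%:R.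

Record hom_query (d d' : nat) := HomQuery {
  hq_pattern : pattern S;
  hq_point : pdom hq_pattern;
  hq_trans : pdom hq_pattern -> 'rV[R]_d -> 'rV[R]_d';
  hq_agg : {mset R} -> R;
  hq_out_gt0 : (0 < d')%N
}.
Arguments hq_trans {d d'} h a x.

Definition hq_result d d' (q : hom_query d d') (D : database S)
    (lambda : adom D -> 'rV[R]_d) (u : adom D) : 'rV[R]_d' :=
  \row_(j < d') hq_agg q
    (seq_mset [seq \prod_a hq_trans q a (lambda (h a)) 0 j
              | h : {ffun pdom (hq_pattern q) -> adom D}
                in Homs (hq_point q) u]).

Record layer (d d' : nat) := Layer {
  nb_queries : nat;
  query_dim : 'I_nb_queries -> nat;
  query : forall i, hom_query d (query_dim i);
  com : (forall i, 'rV[R]_(query_dim i)) -> 'rV[R]_d'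
}.
Arguments query_dim {d d'} l i.
Arguments query {d d'} l i.
Arguments com {d d'} l x.

Definition layer_eval d d' (L : layer d d') (D : database S)
    (lambda : adom D -> 'rV[R]_d) : adom D -> 'rV[R]_d' :=
  fun u => com L (fun i => hq_result (query L i) lambda u).

(* A nonempty sequence of layers with matching dimensions, the first one of
   input dimension [d], followed by a classification function. *)
Inductive network (d : nat) : Type :=
| LastLayer d' (L : layer d d') (cls : 'rV[R]_d' -> bool)
| ConsLayer d' (L : layer d d') (N : network d').

Fixpoint network_accepts d (N : network d) (D : database S)
    (lambda : adom D -> 'rV[R]_d) (v : adom D) : bool :=
  match N with
  | LastLayer _ L cls => cls (layer_eval L lambda v)
  | ConsLayer _ L N' => network_accepts N' (layer_eval L lambda) v
  end.

Definition dhn : Type := network 0.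

(* The type ['rV_0] has a single inhabitant, the empty vector. *)
Definition dhn_accepts (N : dhn) (Dv : pointed_db S) : bool :=
  network_accepts N (fun _ => 0) (db_point Dv).

Fixpoint network_all (P : forall d d', layer d d' -> Prop)
    (Q : forall d, ('rV[R]_d -> bool) -> Prop) d (N : network d) : Prop :=
  match N with
  | LastLayer _ L cls => P _ _ L /\ Q _ cls
  | ConsLayer _ L N' => P _ _ L /\ network_all P Q N'
  end.

Definition is_mean_dhn (N : dhn) : Prop :=
  network_all
    (fun _ _ L => forall i m, hq_agg (query L i) m = mean m)
    (fun _ _ => True) N.

Definition is_connected_dhn (N : dhn) : Prop :=
  network_all
    (fun _ _ L => forall i, gaifman_connected (pfacts (hq_pattern (query L i))))
    (fun _ _ => True) N.

Definition relu_star (x : R) : R := Num.min (Num.max 0 x) 1.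

Definition simple_trans d d' (mu : 'rV[R]_d -> 'rV[R]_d') : Prop :=
  exists (A : 'M[rat]_(d, d')) (b : 'rV[rat]_d'), forall x,
    mu x = map_mx relu_star (x *m map_mx ratr A + map_mx ratr b).

Definition simple_com d d' (L : layer d d') : Prop :=
  exists (A : forall i, 'M[rat]_(query_dim L i, d')) (b : 'rV[rat]_d'),
    forall x : (forall i, 'rV[R]_(query_dim L i)),
      com L x = map_mx relu_star
                (\sum_i x i *m map_mx ratr (A i) + map_mx ratr b).

Definition simple_layer d d' (L : layer d d') : Prop :=
  simple_com L /\ forall i a, simple_trans (hq_trans (query L i) a).

Definition simple_cls d (cls : 'rV[R]_d -> bool) : Prop :=
  exists (i : 'I_d) (c : rat),
    (forall x, cls x = (x 0 i > ratr c)) \/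
    (forall x, cls x = (x 0 i >= ratr c)).

Definition is_simple_dhn (N : dhn) : Prop :=
  network_all simple_layer simple_cls N.

End DHN.
Arguments hq_trans {R S d d'} h a x.
Arguments query_dim {R S d d'} l i.
Arguments query {R S d d'} l i.
Arguments com {R S d d'} l x.

(** * Ratio Hennessy-Milner logic *)

(* In the scope of a quantifier over [n] variables, [ord0 : 'I_n.+1] is the
   free variable x and the other indices are the quantified y_1, ..., y_n.
   A pair [(z, phi)] in [mu] is the conjunct phi(z); [strict] distinguishes
   the threshold [> t] from [>= t].  Conjunctions may be empty; an empty [mu]
   is the base case of the grammar. *)
Inductive rhml (S : schema) : Type :=
| RNeg (phi : rhml S)
| ROr (phi psi : rhml S)
| RExists (strict : bool) (t : rat) (n : nat)
    (mu : seq ('I_n.+1 * rhml S)) (nu : seq (fact S 'I_n.+1)).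

Definition ratio_test (strict : bool) (t : rat) (num den : nat) : bool :=
  if strict then (den != 0%N) && (num%:R / den%:R > t)
  else (den == 0%N) || (num%:R / den%:R >= t).

Fixpoint rhml_holds (S : schema) (D : database S) (phi : rhml S)
    (v : adom D) {struct phi} : bool :=
  match phi with
  | RNeg psi => ~~ rhml_holds psi v
  | ROr psi chi => rhml_holds psi v || rhml_holds chi v
  | RExists strict t n mu nu =>
      let env (w : n.-tuple (adom D)) := tnth [tuple of v :: w] in
      let sat_mu w := all (fun p => rhml_holds p.2 (env w p.1)) mu in
      let sat_nu w :=
        all (fun f => map_fact (fun z => val (env w z)) f \in D) nu in
      ratio_test strict t #|[set w | sat_mu w && sat_nu w]|
                          #|[set w | sat_nu w]|
  end.

Definition rhml_accepts (S : schema) (phi : rhml S) (Dv : pointed_db S) : bool :=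
  rhml_holds phi (db_point Dv).

Fixpoint rhml_connected (S : schema) (phi : rhml S) : bool :=
  match phi with
  | RNeg psi => rhml_connected psi
  | ROr psi chi => rhml_connected psi && rhml_connected chi
  | RExists _ _ n mu nu =>
      [&& has (fun f => ord0 \in args f) nu, gaifman_connected nu
        & all (fun p => rhml_connected p.2) mu]
  end.

(** * Expressive power *)

Definition property (S : schema) := pointed_db S -> Prop.

(* [P] is expressed by a classifier of the class [C], where only pointed
   databases in [K] are considered. *)
Definition expressible (S : schema) (T : Type)
    (accepts : T -> pointed_db S -> bool) (C : T -> Prop)
    (K P : property S) : Prop :=
  exists2 c : T, C c & forall Dv, K Dv -> (accepts c Dv <-> P Dv).

Definition at_least_as_expressive (S : schema) (E2 E1 : property S -> Prop) :
    Prop :=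
  forall P, E1 P -> E2 P.

Definition same_expressive_power (S : schema) (E1 E2 : property S -> Prop) :
    Prop :=
  at_least_as_expressive E1 E2 /\ at_least_as_expressive E2 E1.

Definition any_db (S : schema) : property S := fun _ => True.

Definition degree_le (S : schema) (B : nat) : property S :=
  fun Dv => (degree (db_of Dv) <= B)%N.
Arguments degree_le S B : clear implicits.
Arguments any_db S : clear implicits.

Definition mean_dhn_expr (R : realType) (S : schema) (K : property S) :=
  expressible (@dhn_accepts R S) (@is_mean_dhn R S) K.

Definition connected_mean_dhn_expr (R : realType) (S : schema)
    (K : property S) :=
  expressible (@dhn_accepts R S)
    (fun N => is_mean_dhn N /\ is_connected_dhn N) K.

Definition connected_simple_mean_dhn_expr (R : realType) (S : schema)
    (K : property S) :=
  expressible (@dhn_accepts R S)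
    (fun N => [/\ is_mean_dhn N, is_connected_dhn N & is_simple_dhn N]) K.

Definition rhml_expr (S : schema) (K : property S) :=
  expressible (@rhml_accepts S) (fun _ => True) K.

Definition connected_rhml_expr (S : schema) (K : property S) :=
  expressible (@rhml_accepts S) (fun phi => rhml_connected phi) K.

(* Main.v *)
Require Import Defs.
From mathcomp Require Import all_boot all_order all_algebra.
From mathcomp Require Import finmap multiset reals.
From mathcomp Require Import perm boolp lra.

(** From logic to networks: keep the truth values of a growing list of formulas
    as a 0/1 embedding and add one formula per layer.  For a quantifier, the
    mean over the homomorphisms from the pattern of its atoms is the ratio to be
    tested; on databases of bounded degree a connected pattern has boundedly
    many homomorphisms, so that the ratio stays away from the threshold [t]
    unless it is [t], and a steep enough clipped affine function performs the
    test exactly.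

    From networks to logic: each embedding computed by a connected mean network
    is determined by the truth values of finitely many connected formulas.
    Indeed, if this holds for the embedding [lambda], then the mean over
    [Hom(F^w, D^u)] is a combination, with coefficients that do not depend on
    [D], of the fractions of those homomorphisms that have a given profile of
    truth values; these fractions have bounded denominators, hence are
    determined by finitely many ratio tests. *)

Set Implicit Arguments.
Unset Strict Implicit.
Unset Printing Implicit Defensive.

Import Order.TTheory GRing.Theory Num.Theory.

Local Open Scope fset_scope.
Local Open Scope ring_scope.

(** * Homomorphisms from connected patterns *)

Lemma args_map_fact (S : schema) (V W : Type) (h : V -> W) (f : fact S V) :
  args (map_fact h f) = map h (args f).
Proof. by []. Qed.

Lemma map_fact_comp (S : schema) (U V W : Type) (g : V -> W) (h : U -> V)
    (f : fact S U) : map_fact g (map_fact h f) = map_fact (g \o h) f.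
Proof.
case: f => r t; rewrite /map_fact /=; congr (Tagged _ _).
by apply: val_inj; rewrite /= map_comp.
Qed.

Lemma eq_in_map_fact (S : schema) (V : eqType) (W : Type) (g h : V -> W)
    (f : fact S V) : {in args f, g =1 h} -> map_fact g f = map_fact h f.
Proof.
case: f => r t gh; rewrite /map_fact /=; congr (Tagged _ _).
by apply: val_inj; apply/eq_in_map.
Qed.

Lemma eq_map_fact (S : schema) (V W : Type) (g h : V -> W) (f : fact S V) :
  g =1 h -> map_fact g f = map_fact h f.
Proof. by move=> /funext ->. Qed.

(** The image of an edge is an edge or a single vertex, so walks are sent to walks; [e'] makes [e]
    surjective. It serves both directions: from atoms to patterns and back. *)
Lemma gaifman_connected_map (S : schema) (V W : finType) (e : V -> W)
    (e' : W -> V) (fs : seq (fact S V)) (gs : seq (fact S W)) :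
  cancel e' e -> {in fs, forall f, map_fact e f \in gs} ->
  gaifman_connected fs -> gaifman_connected gs.
Proof.
move=> eK sub /forallP conn; apply/forallP => a; apply/forallP => b.
rewrite -[a]eK -[b]eK.
have /connectP[p + ->] := forallP (conn (e' a)) (e' b).
elim: p (e' a) => [|c p IHp] a' //=.
move=> /andP[/andP[_ /hasP[f ffs /andP[fa fc]]] pp].
apply: connect_trans (IHp _ pp); have [->//|ne] := eqVneq (e a') (e c).
apply: connect1; rewrite /gaifman ne; apply/hasP; exists (map_fact e f).
  exact: sub.
by rewrite args_map_fact !map_f.
Qed.

(** Numbers the values of a pattern so that its point becomes the free variable [ord0]; a
    transposition corrects an arbitrary enumeration. *)
Lemma pointed_enum (V : finType) (w : V) :
  exists n (e : 'I_n.+1 -> V) (e' : V -> 'I_n.+1),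
    [/\ cancel e e', cancel e' e & e ord0 = w].
Proof.
have V1 : #|V| = #|V|.-1.+1 by rewrite prednK //; apply/card_gt0P; exists w.
exists #|V|.-1.
pose g i := enum_val (cast_ord (esym V1) i).
pose s := tperm (g ord0) w.
exists (s \o g), (fun a => cast_ord V1 (enum_rank (s a))).
split=> [i|a|] /=.
- by rewrite tpermK /g enum_valK cast_ordKV.
- by rewrite /g cast_ordK enum_rankK tpermK.
- by rewrite /s tpermL.
Qed.

(** Dictionary between the two ways of counting: maps on a pattern with prescribed value at the
    point, and tuples for the quantified variables. The map [g] is a bijection between them. *)
Lemma card_env (V T : finType) n (e : 'I_n.+1 -> V) (e' : V -> 'I_n.+1)
    (v : T) (P : pred {ffun V -> T}) :
  cancel e e' -> cancel e' e ->
  #|[set h : {ffun V -> T} | (h (e ord0) == v) && P h]| =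
  #|[set w : n.-tuple T | P [ffun a => tnth [tuple of v :: w] (e' a)]]|.
Proof.
move=> eK e'K.
pose g (w : n.-tuple T) : {ffun V -> T} :=
  [ffun a => tnth [tuple of v :: w] (e' a)].
have g_inj : injective g.
  move=> w1 w2 /ffunP g12; apply/eq_from_tnth => i.
  have := g12 (e (lift ord0 i)); rewrite !ffunE eK.
  by rewrite !tnthS.
rewrite -(card_imset _ g_inj); apply: eq_card => h; rewrite inE.
apply/andP/imsetP => [[/eqP hv Ph]|[w + ->]]; last first.
  by rewrite inE => Pw; split=> //; rewrite /g ffunE eK (tnth_nth v).
pose w := [tuple h (e (lift ord0 i)) | i < n].
suff hw : h = g w by exists w => //; rewrite inE -/(g w) -hw.
apply/ffunP => a; rewrite ffunE -{1}[a]e'K.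
case: (unliftP ord0 (e' a)) => [i|] ->; first by rewrite tnthS tnth_mktuple.
by rewrite tnth0.
Qed.

Section HomBound.
Variables (S : schema) (D : database S).

Definition arity_sum : nat := (\sum_(r : S) arity r)%N.

(** Neighbourhoods and balls are lists with repetitions, since only upper bounds on their sizes
    matter. *)
Definition nbhd (v : value) : seq value :=
  flatten [seq args f | f <- enum_fset D & v \in args f].

Definition ball (k : nat) (v : value) : seq value :=
  iter k (fun s => s ++ flatten (map nbhd s)) [:: v].

Lemma size_flatten_le (T U : eqType) (g : T -> seq U) (s : seq T) c :
  {in s, forall x, (size (g x) <= c)%N} ->
  (size (flatten (map g s)) <= size s * c)%N.
Proof.
elim: s => //= x s IHs le_c; rewrite size_cat mulSn leq_add //.
  by rewrite le_c ?mem_head.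
by apply: IHs => y sy; rewrite le_c // inE sy orbT.
Qed.

Lemma size_args_le (f : fact S value) : (size (args f) <= arity_sum)%N.
Proof.
case: f => r t.
by rewrite /args /= size_tuple /arity_sum (bigD1 r) //= leq_addr.
Qed.

Lemma mem_adom (x : value) :
  reflect (exists2 f, f \in D & x \in args f) (x \in adom D).
Proof.
apply: (iffP (bigfcupP _ _ _ _)) => [[f /andP[fD _]]|[f fD xf]].
  by rewrite !inE => xf; exists f.
by exists f; rewrite ?fD ?inE.
Qed.

(** The degree bounds the number of facts around a value of the active domain; any other value has
    an empty neighbourhood. *)
Lemma size_nbhd B v : (degree D <= B)%N -> (size (nbhd v) <= B * arity_sum)%N.
Proof.
move=> degB; rewrite /nbhd.
have le1 := size_flatten_le (g := @args S value)
  (s := [seq f <- enum_fset D | v \in args f]) (fun f _ => size_args_le f).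
apply: leq_trans le1 _; rewrite leq_mul2r; apply/orP; right.
have [vD|vD] := boolP (v \in adom D); last first.
  rewrite (_ : [seq _ <- _ | _] = [::]) //; apply/eqP.
  rewrite -[_ == _]negbK -has_filter; apply/negP => /hasP[f fD vf].
  by case/negP: vD; apply/mem_adom; exists f.
apply: leq_trans degB; apply: leq_trans (leq_bigmax (FSetSub vD)) => /=.
apply: uniq_leq_size; first by rewrite filter_uniq ?fset_uniq.
by move=> f; rewrite mem_filter !inE => /andP[-> ->].
Qed.

Lemma size_ball B k v :
  (degree D <= B)%N -> (size (ball k v) <= (B * arity_sum).+1 ^ k)%N.
Proof.
move=> degB; elim: k => //= k IHk; rewrite size_cat.
have le1 := size_flatten_le (s := ball k v) (fun x _ => size_nbhd x degB).
apply: leq_trans (leq_add (leqnn _) le1) _.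
by rewrite -mulnS expnS mulnC leq_mul2l IHk orbT.
Qed.

(** Adjacent vertices share a fact, whose image is a fact of [D]; hence each edge of the path costs
    one unit of radius. *)
Lemma mem_ball_hom (V : finType) (fs : seq (fact S V)) (h : V -> value) w p :
  all (fun f => map_fact h f \in D) fs -> path (gaifman fs) w p ->
  h (last w p) \in ball (size p) (h w).
Proof.
move=> /allP hD; elim/last_ind: p => [|p c IHp] /=; first by rewrite inE.
rewrite rcons_path last_rcons size_rcons => /andP[/IHp pp /andP[_]].
move=> /hasP[f /hD ffs /andP[fa fc]] /=; rewrite mem_cat; apply/orP; right.
apply/flatten_mapP; exists (h (last w p)) => //.
apply/flatten_mapP; exists (map_fact h f); last by rewrite args_map_fact map_f.
by rewrite mem_filter args_map_fact map_f.
Qed.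

Lemma leq_ball k l v : (k <= l)%N -> {subset ball k v <= ball l v}.
Proof.
move=> /subnK <-; elim: (l - k)%N => //= m IHm x xk.
by rewrite mem_cat IHm.
Qed.

Definition hom_bound B k : nat := (((B * arity_sum).+1 ^ k) ^ k)%N.

(** By connectedness a homomorphism maps every vertex into the ball of radius [#|V|] around [u], and
    [hom_bound] counts all maps into a set of that size. *)
Lemma card_homs_le B (V : finType) (fs : seq (fact S V)) (w : V) (u : adom D) :
  (degree D <= B)%N -> gaifman_connected fs ->
  (#|[set h : {ffun V -> adom D} | (h w == u) &&
      all (fun f => map_fact (fun a => val (h a)) f \in D) fs]|
   <= hom_bound B #|V|)%N.
Proof.
move=> degB /forallP conn.
pose b := [pred x : adom D | val x \in ball #|V| (val u)].
apply: leq_trans (_ : #|b| ^ #|V| <= _)%N.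
  rewrite -(card_ffun_on V); apply: subset_leq_card; apply/subsetP => h.
  rewrite inE => /andP[/eqP hw hD].
  apply/ffun_onP => a; rewrite inE.
  have /connectP[p0 + ->] := forallP (conn w) a.
  (* A path without repeated vertices has fewer than [#|V|] edges. *)
  move=> /shortenP[p pw upw _]; rewrite -hw.
  apply: (@leq_ball (size p)); last exact: (mem_ball_hom (h := val \o h) hD pw).
  by rewrite ltnW // -[_.+1]/(size (w :: p)) -(card_uniqP upw) max_card.
rewrite leq_exp2r; last by apply/card_gt0P; exists w.
apply: leq_trans (size_ball #|V| (val u) degB).
rewrite cardE -(size_map val); apply: uniq_leq_size.
  by rewrite map_inj_uniq ?enum_uniq //; apply: val_inj.
move=> x /mapP[y]; rewrite mem_enum inE => yb ->; exact: yb.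
Qed.

End HomBound.

(** * Affine queries and layers *)

Lemma mean_image (R : realType) (T : finType) (A : {set T}) (F : T -> R) :
  mean (seq_mset [seq F h | h in A]) = (\sum_(h in A) F h) / #|A|%:R.
Proof.
rewrite /mean (perm_big _ (perm_eq_seq_mset _)) /=.
rewrite (perm_size (perm_eq_seq_mset _)) size_map -cardE.
by rewrite big_map big_enum.
Qed.

Lemma relu_star_bool (R : realType) (b : bool) : relu_star (b%:R : R) = b%:R.
Proof.
rewrite /relu_star; case: b => /=; first by rewrite max_r ?ler01 // min_l.
by rewrite max_l // min_l ?ler01.
Qed.

Lemma relu_star_le0 (R : realType) (x : R) : x <= 0 -> relu_star x = 0.
Proof. by move=> x0; rewrite /relu_star max_l // min_l ?ler01. Qed.

Lemma relu_star_ge1 (R : realType) (x : R) : 1 <= x -> relu_star x = 1.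
Proof.
by move=> x1; rewrite /relu_star max_r ?min_r // (le_trans ler01).
Qed.

Section AffineQuery.
Variables (R : realType) (S : schema).

Definition affine_relu d (a : 'cV[rat]_d) (b : rat) (x : 'rV[R]_d) : R :=
  relu_star (\sum_k x 0 k * ratr (a k 0) + ratr b).

Definition affine_query d (F : pattern S) (w : pdom F)
    (A : pdom F -> 'cV[rat]_d) (b : pdom F -> rat) : hom_query R S d 1 :=
  HomQuery w
    (fun a x => map_mx (@relu_star R)
                  (x *m map_mx ratr (A a) + map_mx ratr (const_mx (b a))))
    (@mean R) isT.

Lemma affine_queryE d (F : pattern S) (w : pdom F) A b (D : database S)
    (lambda : adom D -> 'rV[R]_d) (u : adom D) :
  hq_result (affine_query w A b) lambda u 0 0 =
  (\sum_(h in Homs w u) \prod_a affine_relu (A a) (b a) (lambda (h a)))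
    / #|Homs w u|%:R.
Proof.
rewrite mxE [hq_agg _]/= mean_image; congr (_ / _); apply: eq_bigr => h _.
apply: eq_bigr => a _; rewrite !mxE; congr (relu_star (_ + _)).
by apply: eq_bigr => k _; rewrite !mxE.
Qed.

(** One isolated value: its only homomorphism to [u] is constant, so a query on this pattern applies
    its transformation function to the embedding of [u] itself. *)
Definition self_pattern : pattern S := @Pattern S [fset 0%N] fset0.

Definition self_point : pdom self_pattern := FSetSub (fset11 0%N).

Lemma self_patternP (a : pdom self_pattern) : a = self_point.
Proof. by apply: val_inj; case: a => a /=; rewrite inE => /eqP. Qed.

Lemma self_connected : gaifman_connected (pfacts self_pattern).
Proof.
apply/forallP => a; apply/forallP => b.
by rewrite [a]self_patternP [b]self_patternP connect0.
Qed.

Lemma card_Homs_self (D : database S) (u : adom D) : #|Homs self_point u| = 1%N.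
Proof.
apply: (@eq_card1 _ [ffun=> u]) => h; rewrite !inE.
rewrite [X in _ && X](_ : _ = true) ?andbT; last first.
  by apply/allP => f; rewrite inE.
apply/eqP/eqP => [hu|->]; last by rewrite ffunE.
by apply/ffunP => a; rewrite ffunE [a]self_patternP.
Qed.

Lemma self_queryE d a b (D : database S)
    (lambda : adom D -> 'rV[R]_d) (u : adom D) :
  hq_result (affine_query self_point a b) lambda u 0 0 =
  affine_relu (a self_point) (b self_point) (lambda u).
Proof.
rewrite affine_queryE card_Homs_self invr1 mulr1.
rewrite (big_pred1 [ffun=> u]) => [|h].
  rewrite (big_pred1 self_point) ?ffunE // => x.
  by rewrite /= [x]self_patternP eqxx.
have /eqP := card_Homs_self u => /cards1P[h0 hE].
have: [ffun=> u] \in Homs self_point u.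
  by rewrite inE ffunE eqxx; apply/allP => f; rewrite inE.
by rewrite hE !inE => /eqP <-.
Qed.

Lemma affine_relu0 d (b : bool) (x : 'rV[R]_d) :
  affine_relu 0 b%:R x = b%:R.
Proof.
rewrite /affine_relu big1 => [|k _]; last by rewrite mxE rmorph0 mulr0.
by rewrite add0r ratr_nat relu_star_bool.
Qed.

Lemma affine_relu_coord d (j : 'I_d) (x : 'rV[R]_d) :
  affine_relu (\col_k (k == j)%:R) 0 x = relu_star (x 0 j).
Proof.
rewrite /affine_relu rmorph0 addr0 (bigD1 j) //= big1 => [|k kj].
  by rewrite mxE eqxx rmorph1 mulr1 addr0.
by rewrite mxE (negPf kj) rmorph0 mulr0.
Qed.

Lemma affine_query_simple d (F : pattern S) (w : pdom F) A b a :
  simple_trans (hq_trans (@affine_query d F w A b) a).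
Proof. by exists (A a), (const_mx (b a)). Qed.

(* Query 0 computes the mean to be tested, query 1 the indicator of the
   existence of a homomorphism, and the others copy the input. *)
Definition step_layer d (F : pattern S) (w : pdom F)
    (A : pdom F -> 'cV[rat]_d) (b : pdom F -> rat) (theta : R -> R -> R) :
    layer R S d d.+1 :=
  @Layer R S d d.+1 d.+2 (fun _ => 1%N)
    (fun i => match val i with
       | 0%N => affine_query w A b
       | 1%N => affine_query w (fun _ => 0) (fun _ => 1)
       | k.+2 => affine_query self_point (fun _ => \col_j (val j == k)%:R)
                   (fun _ => 0)
       end)
    (fun x => \row_j
       if unlift ord0 j is Some k
       then relu_star (x (lift ord0 (lift ord0 k)) 0 0)
       else theta (x ord0 0 0) (x (lift ord0 ord0) 0 0)).

Lemma step_layer_mean d (F : pattern S) (w : pdom F) A b theta i m :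
  hq_agg (query (@step_layer d F w A b theta) i) m = mean m.
Proof. by case: i => [[|[|k]] ?]. Qed.

Lemma step_layer_connected d (F : pattern S) (w : pdom F) A b theta i :
  gaifman_connected (pfacts F) ->
  gaifman_connected
    (pfacts (hq_pattern (query (@step_layer d F w A b theta) i))).
Proof. by case: i => [[|[|k]] ?] //= _; exact: self_connected. Qed.

Definition simple_theta (theta : R -> R -> R) :=
  exists x y z : rat, forall r e,
    theta r e = relu_star (r * ratr x + e * ratr y + ratr z).

Lemma step_layer_simple d (F : pattern S) (w : pdom F) A b theta :
  simple_theta theta -> simple_layer (@step_layer d F w A b theta).
Proof.
move=> [x [y [z thetaE]]]; split; last first.
  by case=> [[|[|k]] ?] a; exact: affine_query_simple.
(* Output 0 combines queries 0 and 1 with the weights of [theta]; output [j + 1] reads query [j + 2]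
   only. *)
pose M (i : 'I_d.+2) : 'M[rat]_(1, d.+1) :=
  \row_j match val i, unlift ord0 j with
         | 0%N, None => x
         | 1%N, None => y
         | k.+2, Some j' => (val j' == k)%:R
         | _, _ => 0
         end.
exists M, (\row_j if unlift ord0 j is None then z else 0) => X.
apply/rowP => j; rewrite !mxE summxE.
under eq_bigr => i _ do rewrite !mxE big_ord1 !mxE.
rewrite !big_ord_recl /=.
case: (unliftP ord0 j) => [j'|] _ /=; last first.
  rewrite thetaE; congr (relu_star (_ + _)).
  by rewrite big1 ?addr0 // => i _; rewrite rmorph0 mulr0.
rewrite rmorph0 !mulr0 !add0r addr0; congr (relu_star _).
rewrite (bigD1 j') //= big1 => [|i ij].
  by rewrite eqxx rmorph1 mulr1 addr0.
rewrite (_ : (_ == _) = false) ?rmorph0 ?mulr0 //.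
by apply/negbTE; rewrite eq_sym; apply: contra ij => /eqP e; apply/eqP/val_inj.
Qed.

End AffineQuery.

(** * From formulas to networks *)

(** The conjuncts of a quantifier sit inside a list, so its induction hypothesis has to cover all
    members of [mu]. *)
Lemma rhml_nested_ind (S : schema) (P : rhml S -> Prop) :
  (forall phi, P phi -> P (RNeg phi)) ->
  (forall phi psi, P phi -> P psi -> P (ROr phi psi)) ->
  (forall strict t n mu nu, List.Forall (fun p => P p.2) mu ->
     P (@RExists S strict t n mu nu)) ->
  forall phi, P phi.
Proof.
move=> Pneg Por Pex; fix IH 1; case=> [phi|phi psi|strict t n mu nu].
- exact: Pneg.
- exact: Por.
- apply: Pex; elim: mu => [|[z phi] mu IHmu]; first exact: List.Forall_nil.
  by apply: List.Forall_cons IHmu; exact: IH.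
Qed.

(** With denominators at most [M] only finitely many ratios occur, so a slope [K] large enough
    stretches every gap to [t] to at least 1. The second argument of [theta] separates a zero
    denominator from a ratio equal to 0. *)
Lemma threshold_simple (R : realType) (strict : bool) (t : rat) (M : nat) :
  exists2 theta : R -> R -> R, simple_theta theta &
    forall num den, (num <= den)%N -> (den <= M)%N ->
      theta (num%:R / den%:R) (den != 0%N)%:R =
      (ratio_test strict t num den)%:R.
Proof.
pose ratio (p : 'I_M.+1 * 'I_M.+1) : rat := p.1%:R / p.2%:R.
pose K : rat := \sum_p `|ratio p - t|^-1.
(* [K] bounds [`|q - t|^-1] for each of the finitely many ratios [q != t]. *)
have gap num den : (num <= den)%N -> (den <= M)%N ->
    num%:R / den%:R != t -> 1 <= K * `|num%:R / den%:R - t|.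
  move=> nd dM ne; have nM := leq_trans nd dM.
  have pos : 0 < `|num%:R / den%:R - t| by rewrite normr_gt0 subr_eq0.
  rewrite -ler_pdivrMr // mul1r.
  rewrite /K (bigD1 (inord num, inord den)) //= /ratio /= !inordK ?ltnS //.
  by rewrite lerDl sumr_ge0 // => p _; rewrite invr_ge0.
have K0 : 0 <= K by apply: sumr_ge0 => p _; rewrite invr_ge0.
have den0 num den : (num <= den)%N -> den = 0%N -> num = 0%N.
  by move=> + d0; rewrite d0 leqn0 => /eqP.
have ratioE num den : (num%:R / den%:R : R) = ratr (num%:R / den%:R : rat).
  by rewrite [RHS]fmorph_div /= !ratr_nat.
have boolE (b : bool) : (b%:R : R) = ratr (b%:R : rat) by rewrite ratr_nat.
have fold1 (x y z r e : rat) : ratr r * ratr x + ratr e * ratr y + ratr z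
    = ratr (r * x + e * y + z) :> R by rewrite !rmorphD !rmorphM.
have ge1 (z : rat) : 1 <= z -> relu_star (ratr z : R) = 1.
  move=> z1; apply: relu_star_ge1.
  by rewrite -(rmorph1 (ratr : {rmorphism rat -> R})) ler_rat.
have le0 (z : rat) : z <= 0 -> relu_star (ratr z : R) = 0.
  move=> z1; apply: relu_star_le0.
  by rewrite -(rmorph0 (ratr : {rmorphism rat -> R})) ler_rat.
have Kt : - (K * `|t|) <= K * t <= K * `|t|.
  by rewrite -mulrN !ler_wpM2l // ?ler_norm // lerNl -normrN ler_norm.
pose theta (x y z r e : R) := relu_star (r * x + e * y + z).
case: strict.
  (* The function is [K (r - t)] at [e = 1]; at [e = 0], where [r = 0], it is at most 0, as the
     strict test requires. *)
  exists (theta (ratr K) (ratr (K * `|t|)) (ratr (- (K * t) - K * `|t|))).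
    by exists K, (K * `|t|), (- (K * t) - K * `|t|) => r e.
  move=> num den nd dM; rewrite /theta ratioE boolE fold1 /ratio_test.
  have [d0|dn0] /= := eqVneq den 0%N.
    by rewrite d0 invr0 mulr0 le0 //; lra.
  have := gap _ _ nd dM; move: (num%:R / den%:R : rat) => q gapq.
  have [lt_tq|le_qt] := ltP t q.
    have := gapq (negbT (gt_eqF lt_tq)); rewrite gtr0_norm ?subr_gt0 // => gap1.
    by rewrite ge1 //; lra.
  have Kqt : K * q <= K * t by rewrite ler_wpM2l.
  by rewrite le0 //; lra.
(* Here it is [1 + K (r - t)] at [e = 1], and at least 1 at [e = 0], where the test succeeds. *)
exists (theta (ratr K) (ratr (- (K * `|t|))) (ratr (1 - K * t + K * `|t|))).
  by exists K, (- (K * `|t|)), (1 - K * t + K * `|t|) => r e.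
move=> num den nd dM; rewrite /theta ratioE boolE fold1 /ratio_test.
have [d0|dn0] /= := eqVneq den 0%N.
  by rewrite d0 invr0 mulr0 ge1 //; lra.
have := gap _ _ nd dM; move: (num%:R / den%:R : rat) => q gapq.
have [le_tq|lt_qt] := leP t q.
  have Ktq : K * t <= K * q by rewrite ler_wpM2l.
  by rewrite ge1 //; lra.
have := gapq (negbT (lt_eqF lt_qt)); rewrite ltr0_norm ?subr_lt0 // => gap1.
by rewrite le0 //; lra.
Qed.

Lemma threshold_exact (R : realType) (strict : bool) (t : rat) :
  exists theta : R -> R -> R, forall num den,
    theta (num%:R / den%:R) (den != 0%N)%:R = (ratio_test strict t num den)%:R.
Proof.
exists (fun r e => (if strict then (e != 0) && (r > ratr t)
                    else (e == 0) || (r >= ratr t))%:R) => num den.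
have -> : (num%:R / den%:R : R) = ratr (num%:R / den%:R : rat).
  by rewrite [RHS]fmorph_div /= !ratr_nat.
rewrite ltr_rat ler_rat /ratio_test pnatr_eq0 eqb0.
by case: strict; rewrite ?negbK.
Qed.

(** Membership is propositional because no Boolean equality is set up on formulas. *)
Lemma In_tnth (T : Type) (x : T) (s : seq T) :
  List.In x s -> exists j, tnth (in_tuple s) j = x.
Proof.
elim: s => //= y s IHs [->|/IHs[j <-]]; first by exists ord0.
by exists (lift ord0 j); rewrite !(tnth_nth y).
Qed.

Section Compile.
(* With [simple] unset, arbitrary mean networks are built and all databases are
   considered; with [simple] set, the networks are connected and simple, and
   only the databases of degree at most [B] are considered. *)
Variables (R : realType) (S : schema) (simple : bool) (B : nat).

Definition admissible (D : database S) := simple -> (degree D <= B)%N.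

Definition good d (N : network R S d) : Prop :=
  network_all (fun _ _ L => forall i m, hq_agg (query L i) m = mean m)
    (fun _ _ => True) N /\
  (simple ->
   network_all
     (fun _ _ L =>
        forall i, gaifman_connected (pfacts (hq_pattern (query L i))))
     (fun _ _ => True) N /\
   network_all (@simple_layer R S) (@simple_cls R) N).

Definition truth_row (s : seq (rhml S)) (D : database S) (u : adom D) :
    'rV[R]_(size s) :=
  \row_j (rhml_holds (tnth (in_tuple s) j) u)%:R.

(** In continuation style: a network expecting the truth values of [s'] becomes one expecting those
    of [s], in practice by putting layers in front of it. *)
Definition reaches (s s' : seq (rhml S)) : Prop :=
  exists T : network R S (size s') -> network R S (size s),
    forall N, good N -> good (T N) /\
      forall D, admissible D -> forall v : adom D,
        network_accepts (T N) (@truth_row s D) v =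
        network_accepts N (@truth_row s' D) v.

Lemma reaches_refl s : reaches s s.
Proof. by exists id. Qed.

Lemma reaches_trans s1 s2 s3 : reaches s1 s2 -> reaches s2 s3 -> reaches s1 s3.
Proof.
move=> [T12 ok12] [T23 ok23]; exists (T12 \o T23).
move=> N /ok23[/ok12[g12 a12] a23].
by split=> // D admD v; rewrite /= a12 // a23.
Qed.

Definition step_correct s (F : pattern S) (w : pdom F)
    (A : pdom F -> 'cV[rat]_(size s)) (b : pdom F -> rat)
    (theta : R -> R -> R) phi :=
  forall D, admissible D -> forall u : adom D,
    theta ((\sum_(h in Homs w u)
              \prod_a affine_relu (A a) (b a) (truth_row s (h a)))
             / #|Homs w u|%:R)
          (#|Homs w u| != 0%N)%:R = (rhml_holds phi u)%:R :> R.

Lemma step_layer_eval s F w A b theta phi (D : database S) :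
  @step_correct s F w A b theta phi -> admissible D ->
  layer_eval (step_layer w A b theta) (@truth_row s D) =
  @truth_row (phi :: s) D.
Proof.
move=> corr admD; apply/funext => u; apply/rowP => j; rewrite [LHS]mxE [RHS]mxE.
case: (unliftP ord0 j) => [k|] ->.
  rewrite /= self_queryE.
  rewrite (_ : (\col_j0 _) = \col_i (i == k)%:R) //.
  by rewrite affine_relu_coord mxE !relu_star_bool !(tnth_nth phi).
rewrite /= !affine_queryE (tnth_nth phi) /= -(corr D admD u); congr (theta _ _).
(* The mean of constant ones is 1, except that it is 0 when there is no homomorphism. *)
rewrite (eq_bigr (fun=> 1)) => [|h _]; last first.
  by apply: big1 => a _; exact: (affine_relu0 true).
rewrite sumr_const; have [->|ne0] := eqVneq.
  by rewrite mul0r.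
by rewrite divff // pnatr_eq0.
Qed.

Lemma reaches_step s F w A b theta phi :
  (simple -> gaifman_connected (pfacts F)) -> (simple -> simple_theta theta) ->
  @step_correct s F w A b theta phi -> reaches s (phi :: s).
Proof.
move=> connF simF corr; exists (ConsLayer (step_layer w A b theta)).
move=> N [mN sN].
split; last by move=> D admD v /=; rewrite (step_layer_eval corr).
split; first by split=> // i m; exact: step_layer_mean.
move=> si; have [cN siN] := sN si; split; split=> //.
  by move=> i; apply: step_layer_connected; exact: connF.
by apply: step_layer_simple; exact: simF.
Qed.

End Compile.

(** A transformation function sees a single vertex, so the conjuncts of [mu] are grouped by the
    vertex they speak about. *)
Lemma forall_all_fibers (V : finType) (T U : Type) (e : T -> V)
    (P : V -> pred U) (s : seq (T * U)) :
  [forall a, all (P a) [seq p.2 | p <- s & e p.1 == a]] =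
  all (fun p => P (e p.1) p.2) s.
Proof.
elim: s => [|p s IHs] /=; first by apply/forallP.
rewrite -IHs; apply/forallP/andP => [H|[Pp /forallP H] a].
  split; first by have := H (e p.1); rewrite eqxx => /andP[].
  by apply/forallP => a; have := H a; case: ifP => // _ /andP[].
by case: eqP => [<-|_] //=; rewrite Pp H.
Qed.

(** * Layers for the connectives and the quantifiers *)

Section Formulas.
Variables (R : realType) (S : schema).

(** Each member of [l] adds 1 to the weight of one coordinate where it occurs in [s]; repetitions
    add up. *)
Lemma truth_row_sum (s l : seq (rhml S)) :
  List.incl l s ->
  exists A : 'cV[rat]_(size s), forall (D : database S) (u : adom D),
    \sum_k truth_row R s u 0 k * ratr (A k 0) =
    (count (fun phi => rhml_holds phi u) l)%:R.
Proof.
elim: l => [|phi l IHl] ls.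
  by exists 0 => D u; rewrite big1 // => k _; rewrite [_ k 0]mxE rmorph0 mulr0.
have [|A AE] := IHl; first by move=> x xl; apply: ls; right.
have [|j jE] := @In_tnth _ phi s; first by apply: ls; left.
exists (A + \col_k (k == j)%:R) => D u; rewrite /= natrD -AE [RHS]addrC.
rewrite (eq_bigr (fun k => truth_row R s u 0 k * ratr (A k 0) +
  truth_row R s u 0 k * (k == j)%:R)) => [|k _]; last first.
  by rewrite -mulrDr; congr (_ * _); rewrite 2!mxE rmorphD /= ratr_nat.
rewrite big_split /=; congr (_ + _).
rewrite (bigD1 j) //= big1 => [|k kj].
  by rewrite mxE eqxx mulr1 addr0 jE.
by rewrite (negPf kj) mulr0.
Qed.

(** With bias [1 - size l] the sum is 1 if all conjuncts hold and at most 0 otherwise. *)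
Lemma truth_row_conj (s l : seq (rhml S)) :
  List.incl l s ->
  exists A b, forall (D : database S) (u : adom D),
    affine_relu A b (truth_row R s u) =
    (all (fun phi => rhml_holds phi u) l)%:R.
Proof.
move=> /truth_row_sum[A AE]; exists A, (1 - (size l)%:R) => D u.
rewrite /affine_relu AE rmorphB rmorph1 /= ratr_nat all_count.
have := count_size (fun phi => rhml_holds phi u) l.
rewrite leq_eqVlt; case: eqP => [-> _|_ /= lt].
  by rewrite addrC subrK relu_star_ge1.
rewrite relu_star_le0 //.
have : (count (fun phi => rhml_holds phi u) l).+1%:R <= (size l)%:R :> R.
  by rewrite ler_nat.
by rewrite -natr1 => ?; lra.
Qed.

Lemma truth_row_disj (s : seq (rhml S)) phi psi :
  List.In phi s -> List.In psi s ->
  exists A b, forall (D : database S) (u : adom D),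
    affine_relu A b (truth_row R s u) =
    (rhml_holds phi u || rhml_holds psi u)%:R.
Proof.
move=> ps qs; have [|A AE] := @truth_row_sum s [:: phi; psi].
  by move=> x [<-|[<-|]].
exists A, 0 => D u; rewrite /affine_relu AE rmorph0 addr0 /= addn0.
case: (rhml_holds phi u); case: (rhml_holds psi u) => /=.
- by rewrite relu_star_ge1 // ler1n.
- exact: (relu_star_bool R true).
- exact: (relu_star_bool R true).
- exact: (relu_star_bool R false).
Qed.

Lemma truth_row_neg (s : seq (rhml S)) phi :
  List.In phi s ->
  exists A b, forall (D : database S) (u : adom D),
    affine_relu A b (truth_row R s u) = (~~ rhml_holds phi u)%:R.
Proof.
move=> ps; have [|A AE] := @truth_row_sum s [:: phi]; first by move=> x [<-|].
exists (- A), 1 => D u; rewrite /affine_relu.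
rewrite (eq_bigr (fun k => - (truth_row R s u 0 k * ratr (A k 0)))) => [|k _].
  rewrite sumrN AE rmorph1 /= addn0.
  case: (rhml_holds phi u) => /=.
    by rewrite addNr (relu_star_bool R false).
  by rewrite oppr0 add0r (relu_star_bool R true).
by rewrite -mulrN; congr (_ * _); rewrite mxE rmorphN.
Qed.

Section ExistsPattern.
Variables (n : nat) (nu : seq (fact S 'I_n.+1)).

(** All variables become values of the pattern, including those in no atom, because the ratio counts
    assignments of them too. *)
Definition exists_dom : {fset value} := [fset val i | i in 'I_n.+1].

Lemma exists_dom_subproof (i : 'I_n.+1) : val i \in exists_dom.
Proof. by apply/imfsetP; exists i. Qed.

Definition exists_vertex (i : 'I_n.+1) : exists_dom :=
  FSetSub (exists_dom_subproof i).

Definition vertex_index (a : exists_dom) : 'I_n.+1 := inord (val a).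

Lemma exists_vertexK : cancel exists_vertex vertex_index.
Proof. by move=> i; rewrite /vertex_index /= inord_val. Qed.

Lemma vertex_indexK : cancel vertex_index exists_vertex.
Proof.
case=> a adom; apply: val_inj => /=; rewrite inordK //.
by have /imfsetP[i _ /= ai] := adom; rewrite /= ai ltn_ord.
Qed.

Definition exists_pattern : pattern S :=
  @Pattern S exists_dom [fset map_fact exists_vertex f | f in nu].

Definition exists_point : pdom exists_pattern := exists_vertex ord0.

Lemma exists_pattern_connected :
  gaifman_connected nu -> gaifman_connected (pfacts exists_pattern).
Proof.
apply: gaifman_connected_map vertex_indexK _ => f fnu.
by apply/imfsetP; exists f.
Qed.

(** Taking [P] to be [mu] gives the numerator of the ratio, and taking it trivial the
    denominator. *)
Lemma card_Homs_exists (D : database S) (u : adom D)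
    (P : pred {ffun exists_dom -> adom D}) :
  #|[set h in @Homs S exists_pattern exists_point D u | P h]| =
  #|[set w : n.-tuple (adom D) |
      P [ffun a => tnth [tuple of u :: w] (vertex_index a)] &&
      all (fun f => map_fact (fun z => val (tnth [tuple of u :: w] z)) f \in D)
        nu]|.
Proof.
pose Q (h : {ffun exists_dom -> adom D}) := P h &&
  all (fun f => map_fact (fun z => val (h (exists_vertex z))) f \in D) nu.
transitivity #|[set h : {ffun exists_dom -> adom D} |
                 (h (exists_vertex ord0) == u) && Q h]|.
  apply: eq_card => h; rewrite !inE /Q -andbA; congr (_ && _); rewrite andbC.
  congr (_ && _); apply/allP/allP => H f.
    move=> fnu; have /H : map_fact exists_vertex f \in pfacts exists_pattern.
      by apply/imfsetP; exists f.
    by rewrite map_fact_comp.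
  by move=> /imfsetP[g /= gnu ->]; rewrite map_fact_comp; exact: H.
rewrite (card_env _ _ exists_vertexK vertex_indexK).
apply: eq_card => w; rewrite !inE /Q; congr (_ && _); apply: eq_all => f.
apply: (congr1 (fun x => x \in D)); apply: eq_map_fact => z; rewrite ffunE.
by rewrite exists_vertexK.
Qed.

End ExistsPattern.

Variables (simple : bool) (B : nat).

Local Notation reaches := (@reaches R S simple B).

Lemma reaches_self s phi A b :
  (forall D (u : adom D),
     affine_relu A b (truth_row R s u) = (rhml_holds phi u)%:R) ->
  reaches s (phi :: s).
Proof.
move=> AE; apply: (@reaches_step _ _ _ _ _ (self_pattern S) (self_point S)
  (fun _ => A) (fun _ => b) (fun r _ => relu_star r)).
- by move=> _; exact: self_connected.
- move=> _; exists 1, 0, 0 => r e.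
  by rewrite rmorph1 rmorph0 mulr0 !addr0 mulr1.
- move=> D _ u; have /= <- := affine_queryE (self_point S) (fun _ => A)
    (fun _ => b) (@truth_row R S s D) u.
  by rewrite self_queryE AE relu_star_bool.
Qed.

(** At each vertex the transformation function computes the conjunction of its conjuncts. The
    product over the vertices is then the indicator of [mu], and its mean over the homomorphisms is
    the ratio. *)
Lemma reaches_exists s strict t n (mu : seq ('I_n.+1 * rhml S)) nu :
  (simple -> gaifman_connected nu) ->
  List.incl (map snd mu) s ->
  reaches s (RExists strict t mu nu :: s).
Proof.
move=> connu mus.
pose l (a : exists_dom n) :=
  [seq p.2 | p <- mu & exists_vertex p.1 == a].
have /choice[A] : forall a, exists A : 'cV[rat]_(size s) * rat,
    forall (D : database S) (u : adom D),
    affine_relu A.1 A.2 (truth_row R s u) =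
    (all (fun phi => rhml_holds phi u) (l a))%:R.
  move=> a; have [|A [b AE]] := @truth_row_conj s (l a); last by exists (A, b).
  move=> phi phil; apply: mus; move: phil; rewrite /l.
  elim: (mu) => //= p m IHm; case: ifP => _ /=; last by right; apply: IHm.
  by case=> [|/IHm]; [left|right].
move=> AE.
have [theta simtheta thetaE] : exists2 theta : R -> R -> R,
    simple -> simple_theta theta &
    forall num den, (num <= den)%N ->
    (simple -> (den <= hom_bound S B #|{: exists_dom n}|)%N) ->
    theta (num%:R / den%:R) (den != 0%N)%:R = (ratio_test strict t num den)%:R.
  case: (simple); last first.
    by have [theta thE] := threshold_exact R strict t; exists theta.
  have [theta ? thE] :=
    threshold_simple R strict t (hom_bound S B #|{: exists_dom n}|).
  by exists theta => // num den nd dM; apply: thE => //; exact: dM.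
apply: (@reaches_step _ _ _ _ _ (exists_pattern nu) (exists_point nu)
  (fun a => (A a).1) (fun a => (A a).2) theta) => //.
  by move=> /connu; exact: exists_pattern_connected.
move=> D admD u.
pose sat (h : {ffun exists_dom n -> adom D}) :=
  [forall a, all (fun phi => rhml_holds phi (h a)) (l a)].
rewrite (_ : \sum_(h in _) _ =
             #|[set h in Homs (exists_point nu) u | sat h]|%:R); last first.
  rewrite -sum1_card natr_sum big_mkcond [RHS]big_mkcond.
  apply: eq_bigr => h _; rewrite !inE; case: ifP => //= _.
  under eq_bigr => a _ do rewrite AE.
  rewrite /sat; case: forallP => [sath|nsat].
    by rewrite big1 // => a _; rewrite sath.
  have [a na] : exists a, ~~ all (fun phi => rhml_holds phi (h a)) (l a).
    by apply/existsP; rewrite -negb_forall; apply/forallP.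
  by rewrite (bigD1 a) //= (negPf na) mul0r.
rewrite thetaE.
- congr (_%:R); rewrite /=; congr (nat_of_bool (ratio_test _ _ _ _)).
    rewrite card_Homs_exists; apply: eq_card => w; rewrite !inE.
    rewrite /sat forall_all_fibers; congr (_ && _); apply: eq_all => p.
    by rewrite ffunE exists_vertexK.
  have := card_Homs_exists nu u xpredT => /= <-.
  by apply: eq_card => h; rewrite !inE andbT.
- by apply: subset_leq_card; apply/subsetP => h; rewrite inE => /andP[].
- move=> si; apply: (@card_homs_le S D B _ _ (exists_point nu)).
    exact: admD.
  exact/exists_pattern_connected/connu.
Qed.

(** Subformulas are added first; as lists only grow, their truth values remain available. The
    starting list is arbitrary so that several subformulas can be added in turn. *)
Lemma reaches_formula phi s :
  (simple -> rhml_connected phi) ->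
  exists s', [/\ reaches s s', List.incl s s' & List.In phi s'].
Proof.
elim/rhml_nested_ind: phi s =>
  [phi IH|phi psi IH1 IH2|strict t n mu nu IH] s con.
- have [s' [ss' sub ps']] := IH s con.
  have [A [b AE]] := truth_row_neg ps'.
  exists (RNeg phi :: s'); split; last by left.
    apply: reaches_trans ss' _; exact: (@reaches_self _ (RNeg phi) _ _ AE).
  by move=> x /sub; right.
- have [|s1 [ss1 sub1 ps1]] := IH1 s; first by move=> /con /andP[].
  have [|s2 [ss2 sub2 ps2]] := IH2 s1; first by move=> /con /andP[].
  have [A [b AE]] := truth_row_disj (sub2 _ ps1) ps2.
  exists (ROr phi psi :: s2); split; last by left.
    apply: reaches_trans (reaches_trans ss1 ss2) _.
    exact: (@reaches_self _ (ROr phi psi) _ _ AE).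
  by move=> x /sub1/sub2; right.
- have [s' [ss' sub mus']] : exists s', [/\ reaches s s', List.incl s s' &
      List.incl (map snd mu) s'].
    have {con} : simple -> all (fun p => rhml_connected p.2) mu.
      by move=> /con /and3P[].
    elim: IH s => [|p m IHp _ IHm] s con.
      by exists s; split=> //; exact: reaches_refl.
    have [|s1 [ss1 sub1 ps1]] := IHp s; first by move=> /con /andP[].
    have [|s2 [ss2 sub2 ps2]] := IHm s1; first by move=> /con /andP[].
    exists s2; split; first exact: reaches_trans ss1 ss2.
      by move=> x /sub1/sub2.
    by move=> x [<-|/ps2 //]; exact: sub2.
  exists (RExists strict t mu nu :: s'); split; last by left.
    apply: reaches_trans ss' _; apply: reaches_exists => //.
    by move=> /con /and3P[].
  by move=> x /sub; right.
Qed.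

Lemma formula_to_network phi :
  (simple -> rhml_connected phi) ->
  exists2 N : network R S 0, good simple N &
    forall Dv, admissible simple B (db_of Dv) ->
      dhn_accepts N Dv = rhml_accepts phi Dv.
Proof.
move=> con; have [s [[T TE] _ phis]] := reaches_formula [::] con.
have [j jE] := In_tnth phis.
pose L := step_layer (self_point S) (fun _ => \col_k (k == j)%:R) (fun _ => 0)
  (fun r _ : R => relu_star r).
have corr : step_correct simple B (self_point S)
    (fun _ => \col_k (k == j)%:R) (fun _ => 0) (fun r _ : R => relu_star r) phi.
  move=> D _ u; have /= <- := affine_queryE (self_point S)
    (fun _ => \col_k (k == j)%:R) (fun _ => 0) (@truth_row R S s D) u.
  by rewrite self_queryE affine_relu_coord mxE jE !relu_star_bool.
pose N := LastLayer L (fun x => x 0 ord0 > ratr 0).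
have goodN : good simple N.
  split; first by split=> // i m; exact: step_layer_mean.
  move=> _; split; split=> //.
  - by move=> i; apply: step_layer_connected; exact: self_connected.
  - apply: step_layer_simple; exists 1, 0, 0 => r e.
    by rewrite rmorph1 rmorph0 mulr0 !addr0 mulr1.
  - by exists ord0, 0; left.
have [gT acc] := TE _ goodN; exists (T N) => // -[D v] admD.
rewrite /dhn_accepts /rhml_accepts /=.
(* The initial embedding is the truth row of the empty list. *)
rewrite (_ : (fun _ => 0) = @truth_row R S [::] D); last first.
  by apply/funext => u; apply/rowP; case.
rewrite (acc D admD v).
rewrite -[network_accepts _ _ _]/
  (ratr 0 < layer_eval L (@truth_row R S s D) v 0 ord0).
rewrite (step_layer_eval corr) // mxE rmorph0.
by rewrite ltr0n lt0b (tnth_nth phi).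
Qed.

End Formulas.

(** * From networks to formulas *)

Section Definable.
Variables (S : schema) (B : nat).

(** The points compared may lie in different databases: the formulas determine the value of [f]
    uniformly over all databases of degree at most [B]. *)
Definition definable (T : Type) (f : forall D : database S, adom D -> T) :=
  exists (I : finType) (phi : I -> rhml S),
    (forall i, rhml_connected (phi i)) /\
    forall (D D' : database S) (u : adom D) (u' : adom D'),
      (degree D <= B)%N -> (degree D' <= B)%N ->
      (forall i, rhml_holds (phi i) u = rhml_holds (phi i) u') ->
      f D u = f D' u'.

Lemma definable_const (T : Type) (x : T) : definable (fun _ _ => x).
Proof. by exists void, (fun v : void => match v with end); split=> // -[]. Qed.

(** The disjoint sum of the finite families works. [T] depends on [j] since the queries of a layer
    may differ in output dimension. *)
Lemma definable_from (J : finType) (T : J -> Type) (U : Type)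
    (f : forall j (D : database S), adom D -> T j)
    (g : forall D : database S, adom D -> U) :
  (forall j, definable (f j)) ->
  (forall (D D' : database S) (u : adom D) (u' : adom D'),
     (forall j, f j D u = f j D' u') -> g D u = g D' u') ->
  definable g.
Proof.
move=> def fg.
pose I j : finType := sval (cid (def j)).
have defI j := svalP (cid (def j)).
pose phi j : I j -> rhml S := sval (cid (defI j)).
exists {j : J & I j}, (fun ji => phi (tag ji) (tagged ji)); split.
  by move=> [j i]; have [con _] := svalP (cid (defI j)); exact: con.
move=> D D' u u' degD degD' eq_phi; apply: fg => j.
have [_ fE] := svalP (cid (defI j)); apply: fE => // i.
exact: (eq_phi (Tagged I i)).
Qed.

Lemma definable_from2 (T1 T2 U : Type)
    (f1 : forall D : database S, adom D -> T1)
    (f2 : forall D : database S, adom D -> T2)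
    (g : forall D : database S, adom D -> U) :
  definable f1 -> definable f2 ->
  (forall (D D' : database S) (u : adom D) (u' : adom D'),
     f1 D u = f1 D' u' -> f2 D u = f2 D' u' -> g D u = g D' u') ->
  definable g.
Proof.
move=> def1 def2 fg.
pose f (b : bool) : forall D : database S, adom D -> if b then T1 else T2 :=
  match b with true => f1 | false => f2 end.
apply: (@definable_from _ _ _ f) => [[]//|D D' u u' eqf].
by apply: fg; [exact: (eqf true)|exact: (eqf false)].
Qed.

(** For each truth vector a pointed database realising it is chosen, and [G] is the value of [f]
    there; definability makes the choice irrelevant. Unrealised vectors get [x0]. *)
Lemma definable_factor (T : Type) (x0 : T)
    (f : forall D : database S, adom D -> T) :
  definable f ->
  exists (I : finType) (phi : I -> rhml S) (G : {ffun I -> bool} -> T),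
    (forall i, rhml_connected (phi i)) /\
    forall (D : database S) (u : adom D), (degree D <= B)%N ->
      f D u = G [ffun i => rhml_holds (phi i) u].
Proof.
move=> [I [phi [con fE]]].
pose P (b : {ffun I -> bool}) (Du : {D : database S & adom D}) :=
  (degree (tag Du) <= B)%N /\ [ffun i => rhml_holds (phi i) (tagged Du)] = b.
pose G b := if pselect (exists Du, P b Du) is left h
            then f _ (tagged (sval (cid h))) else x0.
exists I, phi, G; split=> // D u degD.
rewrite /G; case: pselect => [h|[]]; last first.
  by exists (Tagged (fun D : database S => adom D) u).
case: (svalP (cid h)) => degD' /ffunP eqb; apply: fE => // i.
by have := eqb i; rewrite !ffunE.
Qed.

(** * Guards and nullary facts *)

Section Guards.

Definition exchange (i j : nat) : nat :=
  if j == i then 0%N else if j == 0%N then i else j.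

Lemma exchangeK i : involutive (exchange i).
Proof.
move=> j; rewrite /exchange; have [->|ji] := eqVneq j i.
  by case: eqP => // <-.
by have [->|j0] := eqVneq j 0%N; rewrite ?eqxx // (negPf ji) (negPf j0).
Qed.

Lemma exchange_lt i j m : (i < m)%N -> (j < m)%N -> (exchange i j < m)%N.
Proof.
move=> im jm; rewrite /exchange.
case: ifP => _; first by apply: leq_ltn_trans im.
by case: ifP.
Qed.

Variables (r : S) (i : 'I_(arity r)).

(* The atom of symbol [r] with pairwise distinct variables, the free variable
   [ord0] being at position [i].  As every value of a database occurs in one of
   its facts, some guard can be satisfied at each value; conjoined with a
   nullary atom, a guard turns it into a connected formula. *)
Definition guard : fact S 'I_(arity r).-1.+1 :=
  Tagged (fun r : S => (arity r).-tuple 'I__)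
    [tuple inord (exchange i j) | j < arity r].

Lemma mem_guard (z : 'I_(arity r).-1.+1) : z \in args guard.
Proof.
have arE : (arity r).-1.+1 = arity r.
  by rewrite prednK // (leq_trans _ (ltn_ord i)).
have zr : (exchange i z < arity r)%N.
  by apply: exchange_lt => //; rewrite -[X in (_ < X)%N]arE ltn_ord.
apply/mapP; exists (Ordinal zr); first by rewrite mem_enum.
by apply: val_inj; rewrite /= exchangeK inord_val.
Qed.

(** All variables occur in the guard, so it alone makes the Gaifman graph complete. *)
Lemma guard_connected (fs : seq (fact S 'I_(arity r).-1.+1)) :
  guard \in fs ->
  has (fun f => ord0 \in args f) fs && gaifman_connected fs.
Proof.
move=> gfs; apply/andP; split.
  by apply/hasP; exists guard; rewrite ?mem_guard.
apply/forallP => a; apply/forallP => b.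
have [->|ab] := eqVneq a b; first exact: connect0.
apply: connect1; rewrite /gaifman ab.
by apply/hasP; exists guard; rewrite ?mem_guard.
Qed.

Lemma guard_env (D : database S) (t : (arity r).-tuple value) (u : adom D) :
  Tagged (fun r : S => (arity r).-tuple value) t \in D -> tnth t i = val u ->
  exists w : (arity r).-1.-tuple (adom D),
    map_fact (fun z => val (tnth [tuple of u :: w] z)) guard \in D.
Proof.
move=> tD tu.
have arE : (arity r).-1.+1 = arity r.
  by rewrite prednK // (leq_trans _ (ltn_ord i)).
have memD (z : 'I_(arity r).-1.+1) : nth 0%N t (exchange i z) \in adom D.
  apply/mem_adom; exists (Tagged (fun r : S => (arity r).-tuple value) t) => //.
  apply: mem_nth; rewrite size_tuple; apply: exchange_lt => //.
  by rewrite -[X in (_ < X)%N]arE ltn_ord.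
exists [tuple FSetSub (memD (lift ord0 k)) | k < (arity r).-1].
suff -> : map_fact (fun z => val (tnth [tuple of u ::
    [tuple FSetSub (memD (lift ord0 k)) | k < (arity r).-1]] z)) guard =
  Tagged (fun r : S => (arity r).-tuple value) t by [].
rewrite /map_fact; congr (Tagged _ _); apply: eq_from_tnth => j.
rewrite tnth_map tnth_mktuple.
transitivity
  (nth 0%N t (exchange i (inord (exchange i j) : 'I_(arity r).-1.+1))).
  case: (unliftP ord0 (inord (exchange i j) : 'I_(arity r).-1.+1)) => [k|] ->.
    by rewrite tnthS tnth_mktuple.
  by rewrite tnth0 -tu (tnth_nth 0%N) /exchange /=; case: eqP => // <-.
rewrite inordK; last first.
  by apply: leq_trans (exchange_lt (ltn_ord i) (ltn_ord j)) _; exact: leqSpred.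
by rewrite exchangeK -tnth_nth.
Qed.

End Guards.

Lemma guard_ex (D : database S) (u : adom D) :
  exists (r : S) (i : 'I_(arity r)) (w : (arity r).-1.-tuple (adom D)),
    map_fact (fun z => val (tnth [tuple of u :: w] z)) (guard i) \in D.
Proof.
have /mem_adom[[r t] tD /tnthP[i ui]] := valP u.
by exists r, i; apply: guard_env tD _.
Qed.

Lemma definable_nullary_fact (g : fact S value) :
  args g = [::] -> definable (fun D _ => g \in D).
Proof.
move=> g0.
(* Ratios are never negative, so the strict test against -1 only says that the denominator is
   nonzero. *)
pose psi (ri : {r : S & 'I_(arity r)}) : rhml S :=
  RExists true (-1) [::] [:: map_fact (fun=> ord0) g; guard (tagged ri)].
have gE V (h : V -> value) (h' : value -> V) : map_fact h (map_fact h' g) = g.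
  rewrite map_fact_comp (eq_in_map_fact (h := id)) => [|x]; last by rewrite g0.
  case: g {psi g0} => r t; rewrite /map_fact; congr (Tagged _ _).
  by apply: val_inj; rewrite /= map_id.
have holdsE (D : database S) (u : adom D) ri : rhml_holds (psi ri) u =
    (g \in D) && [exists w : (arity (tag ri)).-1.-tuple (adom D),
       map_fact (fun z => val (tnth [tuple of u :: w] z)) (guard (tagged ri))
         \in D].
  rewrite /= andb_idr => [|_]; last first.
    by rewrite (lt_le_trans (_ : _ < 0)) ?divr_ge0 ?ltrN10.
  rewrite -lt0n; apply/card_gt0P/andP => [[w]|[gD /existsP[w gw]]].
    by rewrite inE gE andbT => /andP[-> ?]; split=> //; apply/existsP; exists w.
  by exists w; rewrite inE gE gD gw.
exists {r : S & 'I_(arity r)}, psi; split.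
  move=> ri; have /andP[h c] := @guard_connected _ (tagged ri)
    [:: map_fact (fun=> ord0) g; guard (tagged ri)] (mem_last _ [:: _]).
  exact/and3P.
(* The guard satisfied at [u] depends on [u], which is why the formulas for all guards are
   compared. *)
have sub (D D' : database S) (u : adom D) (u' : adom D') :
    (forall ri, rhml_holds (psi ri) u = rhml_holds (psi ri) u') ->
    g \in D -> g \in D'.
  move=> eq_psi gD; have [r [i [w gw]]] := guard_ex u.
  have : rhml_holds (psi (Tagged (fun r : S => 'I_(arity r)) i)) u.
    by rewrite holdsE gD; apply/existsP; exists w.
  by rewrite eq_psi holdsE => /andP[].
move=> D D' u u' _ _ eq_psi; apply/idP/idP; apply: sub => //.
Qed.

(** Disjunctive normal form over the truth vectors accepted by [G]. A symbol of positive arity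
    provides [top]; without one there is no connected formula at all. *)
Lemma definable_formula (f : forall D : database S, adom D -> bool) :
  (exists r : S, (0 < arity r)%N) -> definable f ->
  exists2 phi, rhml_connected phi &
    forall (D : database S) (u : adom D), (degree D <= B)%N ->
      rhml_holds phi u = f D u.
Proof.
move=> [r0 ar0] /(definable_factor false)[I [phi [G [con fE]]]].
have [top top_con topE] : exists2 top : rhml S, rhml_connected top &
    forall (D : database S) (u : adom D), rhml_holds top u.
  pose psi := RExists true 0 [::] [:: guard (Ordinal ar0)].
  exists (ROr psi (RNeg psi)) => [|D u]; last by rewrite /= orbN.
  have /andP[h c] := guard_connected (mem_head (guard (Ordinal ar0)) [::]).
  by apply/andP; split; apply/and3P; split.
pose conj (s : seq (rhml S)) :=
  foldr (fun p q => RNeg (ROr (RNeg p) (RNeg q))) top s.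
have conjE s D (u : adom D) :
    rhml_holds (conj s) u = all (fun p => rhml_holds p u) s.
  elim: s => [|p s /= IHs] //=; first exact: topE.
  by rewrite IHs negb_or !negbK.
have conj_con s : all (@rhml_connected S) s -> rhml_connected (conj s).
  by elim: s => //= p s IHs /andP[-> /IHs ->].
pose disj (s : seq (rhml S)) := foldr (@ROr S) (RNeg top) s.
have disjE s D (u : adom D) :
    rhml_holds (disj s) u = has (fun p => rhml_holds p u) s.
  by elim: s => [|p s /= ->] //=; rewrite topE.
have disj_con s : all (@rhml_connected S) s -> rhml_connected (disj s).
  by elim: s => //= p s IHs /andP[-> /IHs ->].
pose lit (b : {ffun I -> bool}) i := if b i then phi i else RNeg (phi i).
exists (disj [seq conj [seq lit b i | i <- enum I]
             | b <- enum {ffun I -> bool} & G b]).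
  apply: disj_con; rewrite all_map; apply/allP => b _ /=.
  apply: conj_con; rewrite all_map; apply/allP => i _ /=.
  by rewrite /lit; case: (b i) => /=; exact: con.
move=> D u degD; rewrite disjE has_map fE //.
have litE b : all (fun p => rhml_holds p u) [seq lit b i | i <- enum I] =
              (b == [ffun i => rhml_holds (phi i) u]).
  rewrite all_map; apply/allP/eqP => [H|-> i _].
    apply/ffunP => i; have := H i; rewrite mem_enum /= ffunE /lit => /(_ isT).
    by case: (b i) => /= [->|/negPf ->].
  by rewrite /= /lit ffunE; case H: (rhml_holds (phi i) u); rewrite /= H.
apply/hasP/idP => [[b] /=|Gu].
  by rewrite mem_filter conjE litE => /andP[Gb _] /eqP <-.
exists [ffun i => rhml_holds (phi i) u].
  by rewrite mem_filter Gu mem_enum.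
by rewrite /= conjE litE.
Qed.

End Definable.

(* The value 2 = 2 / 1 is above every ratio, so the test against it detects
   that the denominator is zero. *)
Lemma ratio_test_inj (M m k m' k' : nat) :
  (m <= k)%N -> (m' <= k')%N -> (k <= M)%N -> (k' <= M)%N ->
  (forall a b : 'I_M.+3, ratio_test false (a%:R / b%:R) m k =
                         ratio_test false (a%:R / b%:R) m' k') ->
  m%:R / k%:R = m'%:R / k'%:R :> rat.
Proof.
have den0 (x y x' y' : nat) : (x' <= y')%N ->
    (forall a b : 'I_M.+3, ratio_test false (a%:R / b%:R) x y =
                           ratio_test false (a%:R / b%:R) x' y') ->
    y = 0%N -> y' = 0%N.
  move=> xy' H y0; have lt2 : (2 < M.+3)%N by [].
  have lt1 : (1 < M.+3)%N by [].
  have := H (Ordinal lt2) (Ordinal lt1); rewrite /ratio_test y0 eqxx /= divr1.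
  have [//|y'0] := eqVneq y' 0%N => /esym.
  have y'gt0 : 0 < y'%:R :> rat by rewrite ltr0n lt0n.
  rewrite /= ler_pdivlMr // => le2.
  have : x'%:R <= y'%:R :> rat by rewrite ler_nat.
  by move=> /(le_trans le2); rewrite ger_pMl // (ler_nat _ 2 1).
have le (x y x' y' : nat) : (x <= y)%N -> (x' <= y')%N -> (y <= M)%N ->
    (forall a b : 'I_M.+3, ratio_test false (a%:R / b%:R) x y =
                           ratio_test false (a%:R / b%:R) x' y') ->
    (x%:R / y%:R <= x'%:R / y'%:R :> rat).
  move=> xy xy' yM H; have [y0|y0] := eqVneq y 0%N.
    by rewrite y0 invr0 mulr0 divr_ge0.
  have xM := leq_trans xy yM.
  (* The first fraction passes the test against itself, hence so does the second. *)
  have := H (inord x) (inord y).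
  have leM : (M <= M.+2)%N by rewrite leqW.
  rewrite /ratio_test !inordK ?ltnS ?(leq_trans xM) ?(leq_trans yM) //.
  rewrite lexx orbT => /esym /orP[/eqP y'0|//].
  by case/eqP: y0; apply: (den0 x' y' x y xy _ y'0) => a b; rewrite H.
move=> mk mk' kM kM' H; apply/eqP; rewrite eq_le.
by apply/andP; split; apply: le => // a b; rewrite H.
Qed.

Lemma rhml_holds_exists (S : schema) (D : database S) (u : adom D) strict t n
    (mu : seq ('I_n.+1 * rhml S)) nu :
  let env (w : n.-tuple (adom D)) := tnth [tuple of u :: w] in
  let sat_nu w :=
    all (fun f => map_fact (fun z => val (env w z)) f \in D) nu in
  rhml_holds (RExists strict t mu nu) u =
  ratio_test strict t
    #|[set w | all (fun p => rhml_holds p.2 (env w p.1)) mu && sat_nu w]|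
    #|[set w | sat_nu w]|.
Proof. by []. Qed.

(** * Definability of the result of one query *)

Section Query.
Variables (R : realType) (S : schema) (B : nat).
Variables (d d' : nat) (lambda : forall D : database S, adom D -> 'rV[R]_d).
Variable q : hom_query R S d d'.
Hypothesis lambda_def : definable B lambda.
Hypothesis q_mean : forall m, hq_agg q m = mean m.
Hypothesis q_conn : gaifman_connected (pfacts (hq_pattern q)).

Local Notation V := (pdom (hq_pattern q)).
Local Notation w := (hq_point q).
Local Notation fs := (pfacts (hq_pattern q)).

Lemma hq_result_mean (D : database S) (u : adom D) j :
  hq_result q (lambda (D := D)) u 0 j =
  (\sum_(h in Homs w u) \prod_a hq_trans q a (lambda (h a)) 0 j)
    / #|Homs w u|%:R.
Proof. by rewrite mxE q_mean mean_image. Qed.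

(* A connected pattern whose point occurs in no fact has no other value, and
   all its facts are nullary. *)
Lemma definable_query_isolated :
  ~~ has (fun f => w \in args f) fs ->
  definable B (fun D u => hq_result q (lambda (D := D)) u).
Proof.
move=> /hasPn isol.
have V1 (a : V) : a = w.
  have /connectP[[|c p] //= + _] := forallP (forallP q_conn w) a.
  by move=> /andP[/andP[_ /hasP[f /isol/negPf wf]]]; rewrite wf.
have args0 f : f \in fs -> args f = [::].
  move=> /isol; case: (args f) => // a s; rewrite (V1 a).
  by rewrite inE eqxx.
pose c (f : fact S V) : fact S value := map_fact (fun=> 0%N) f.
pose ok (D : database S) := all (fun f => c f \in D) fs.
have ok_def : definable B (fun D (_ : adom D) => ok D).
  apply: (@definable_from _ _ fs (fun=> bool) _
    (fun f D (_ : adom D) => c (val f) \in D)) => [f|D D' u u' eqc].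
    by apply: definable_nullary_fact; rewrite args_map_fact args0 ?(valP f).
  by apply: eq_in_all => f ffs; exact: (eqc (FSetSub ffs)).
apply: definable_from2 lambda_def ok_def _ => D D' u u' eq_lambda eq_ok.
have HomsE (D0 : database S) (u0 : adom D0) :
    Homs w u0 = if ok D0 then [set [ffun=> u0]] else set0.
  apply/setP => h; rewrite inE.
  have -> : all (fun f => map_fact (fun a => val (h a)) f \in D0) fs = ok D0.
    apply: eq_in_all => f ffs; apply: (congr1 (fun x => x \in D0)).
    by apply: eq_in_map_fact => a; rewrite args0.
  case: (ok D0); rewrite ?andbF ?andbT !inE //.
  apply/eqP/eqP => [hw|->]; last by rewrite ffunE.
  by apply/ffunP => a; rewrite ffunE [a]V1.
apply/rowP => j; rewrite !hq_result_mean !HomsE eq_ok.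
case: (ok D'); last by rewrite !big_set0 !cards0 !mul0r.
rewrite !big_set1 !cards1; congr (_ / _); apply: eq_bigr => a _.
by rewrite !ffunE eq_lambda.
Qed.

(** As the point occurs in a fact, the atoms [nu] read off the pattern are those of a connected
    quantifier. The product computed for a homomorphism depends only on its profile. *)
Lemma definable_query_linked :
  has (fun f => w \in args f) fs ->
  definable B (fun D u => hq_result q (lambda (D := D)) u).
Proof.
move=> /hasP[f0 f0fs wf0].
have [I [phi [G [con lambdaE]]]] := definable_factor (0 : 'rV[R]_d) lambda_def.
have [n [e [e' [eK e'K ew]]]] := pointed_enum w.
pose nu : seq (fact S 'I_n.+1) := map (map_fact e') fs.
pose lit b psi : rhml S := if b then psi else RNeg psi.
have litE D (u : adom D) b psi :
    rhml_holds (lit b psi) u = (rhml_holds psi u == b).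
  by case: b; rewrite /= ?eqb_id ?eqbF_neg.
pose profile := {ffun V -> {ffun I -> bool}}.
(* One literal for each vertex and formula: together they prescribe the profile [p] exactly. *)
pose mu (p : profile) : seq ('I_n.+1 * rhml S) :=
  [seq (e' x.1, lit (p x.1 x.2) (phi x.2)) | x <- enum {: V * I}].
pose M := hom_bound S B #|{: V}|.
pose psi (x : profile * 'I_M.+3 * 'I_M.+3) : rhml S :=
  RExists false (x.1.2%:R / x.2%:R) (mu x.1.1) nu.
pose bits (D : database S) (u : adom D) : {ffun I -> bool} :=
  [ffun i => rhml_holds (phi i) u].
pose prof (D : database S) (h : {ffun V -> adom D}) : profile :=
  [ffun a => bits D (h a)].
pose num (D : database S) (u : adom D) (p : profile) :=
  #|[set h in Homs w u | prof D h == p]|.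
have psiE D (u : adom D) x : rhml_holds (psi x) u =
    ratio_test false (x.1.2%:R / x.2%:R) (num D u x.1.1) #|Homs w u|.
  pose facts (h : {ffun V -> adom D}) :=
    all (fun f => map_fact (fun a => val (h a)) f \in D) fs.
  have nuE (t : n.-tuple (adom D)) :
      all (fun f => map_fact (fun z => val (tnth [tuple of u :: t] z)) f \in D)
        nu
      = facts [ffun a => tnth [tuple of u :: t] (e' a)].
    rewrite all_map; apply: eq_all => f; apply: (congr1 (fun x => x \in D)).
    by rewrite map_fact_comp; apply: eq_map_fact => a; rewrite /= ffunE.
  rewrite rhml_holds_exists; congr (ratio_test _ _ _ _).
    rewrite (_ : num D u x.1.1 = #|[set h : {ffun V -> adom D} |
        (h (e ord0) == u) && ((prof D h == x.1.1) && facts h)]|); last first.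
      by apply: eq_card => h; rewrite !inE ew andbAC andbA.
    rewrite (card_env _ _ eK e'K); apply: eq_card => t; rewrite !inE nuE.
    congr (_ && _); rewrite all_map; apply/allP/eqP => [H|<- ai _].
      apply/ffunP => a; rewrite ffunE; apply/ffunP => i; rewrite !ffunE.
      by have := H (a, i) (mem_enum _ _); rewrite /preim inE litE => /eqP.
    by rewrite /preim inE litE !ffunE eqxx.
  rewrite (_ : Homs w u = [set h : {ffun V -> adom D} |
      (h (e ord0) == u) && facts h]); last by apply/setP => h; rewrite !inE ew.
  by rewrite (card_env _ _ eK e'K); apply: eq_card => t; rewrite !inE nuE.
exists (profile * 'I_M.+3 * 'I_M.+3)%type, psi; split=> [x|].
  apply/and3P; split.
  - apply/hasP; exists (map_fact e' f0); first exact: map_f.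
    by rewrite args_map_fact -(eK ord0) ew map_f.
  - by apply: gaifman_connected_map eK _ q_conn => f ffs; exact: map_f.
  - rewrite all_map; apply/allP => ai _ /=.
    by rewrite /lit; case: (x.1.1 _ _) => /=; exact: con.
move=> D D' u u' degD degD' eq_psi.
have num_le D0 (u0 : adom D0) p : (num D0 u0 p <= #|Homs w u0|)%N.
  by apply: subset_leq_card; apply/subsetP => h; rewrite inE => /andP[].
have ratio_eq p : (num D u p)%:R / #|Homs w u|%:R =
                  (num D' u' p)%:R / #|Homs w u'|%:R :> R.
  have : (num D u p)%:R / #|Homs w u|%:R =
         (num D' u' p)%:R / #|Homs w u'|%:R :> rat.
    apply: (@ratio_test_inj M) => //; try exact: card_homs_le.
    by move=> a b; have := eq_psi (p, a, b); rewrite !psiE.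
  by move=> /(congr1 (@ratr R)); rewrite !fmorph_div /= !ratr_nat.
have resE D0 (u0 : adom D0) j : (degree D0 <= B)%N ->
    hq_result q (lambda (D := D0)) u0 0 j =
    \sum_p ((num D0 u0 p)%:R / #|Homs w u0|%:R) *
            \prod_a hq_trans q a (G (p a)) 0 j.
  move=> degD0; rewrite hq_result_mean.
  rewrite (partition_big (prof D0) xpredT) //= mulr_suml.
  apply: eq_bigr => p _; rewrite mulrAC; congr (_ / _).
  rewrite (eq_bigr (fun=> \prod_a hq_trans q a (G (p a)) 0 j)).
    rewrite sumr_const mulr_natl; congr (_ *+ _).
    by apply: eq_card => h; rewrite [RHS]inE.
  move=> h /andP[_ /eqP <-]; apply: eq_bigr => a _.
  by rewrite lambdaE // ffunE.
apply/rowP => j; rewrite !resE //; apply: eq_bigr => p _.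
by rewrite ratio_eq.
Qed.

Lemma definable_query :
  definable B (fun D u => hq_result q (lambda (D := D)) u).
Proof.
have [linked|isolated] := boolP (has (fun f => w \in args f) fs).
  exact: definable_query_linked.
exact: definable_query_isolated.
Qed.

End Query.

(** Each layer preserves definability, its output being a function of its query results; [lambda] is
    arbitrary for the induction. *)
Lemma definable_network (R : realType) (S : schema) (B d : nat)
    (N : network R S d) (lambda : forall D : database S, adom D -> 'rV[R]_d) :
  network_all (fun _ _ L => forall i m, hq_agg (query L i) m = mean m)
    (fun _ _ => True) N ->
  network_all
    (fun _ _ L => forall i, gaifman_connected (pfacts (hq_pattern (query L i))))
    (fun _ _ => True) N ->
  definable B lambda ->
  definable B (fun D u => network_accepts N (lambda D) u).
Proof.
have layer_def d1 d2 (L : layer R S d1 d2)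
    (lam : forall D : database S, adom D -> 'rV[R]_d1) :
    (forall i m, hq_agg (query L i) m = mean m) ->
    (forall i, gaifman_connected (pfacts (hq_pattern (query L i)))) ->
    definable B lam -> definable B (fun D u => layer_eval L (lam D) u).
  move=> meanL connL lam_def.
  apply: (@definable_from _ _ _ (fun i => 'rV[R]_(query_dim L i)) _
    (fun i D u => hq_result (query L i) (lam D) u)) => [i|D D' u u' eqL].
    by apply: definable_query => //; exact: meanL.
  by congr (com L _); apply: functional_extensionality_dep.
elim: N lambda => [d1 d2 L cls|d1 d2 L N IHN] lambda /=.
  move=> [meanL _] [connL _] /(layer_def _ _ L _ meanL connL) def.
  apply: (@definable_from2 _ _ _ _ _ _ _ _ def def) => D D' u u' eqL _.
  by rewrite eqL.
move=> [meanL meanN] [connL connN] /(layer_def _ _ L _ meanL connL) def.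
exact: IHN meanN connN def.
Qed.

(** * Comparison of the classes *)

Section Comparison.
Variables (R : realType) (S : schema).

Lemma mean_dhn_ge_rhml :
  at_least_as_expressive (@mean_dhn_expr R S (any_db S))
                         (@rhml_expr S (any_db S)).
Proof.
move=> P [phi _ phiP].
have [|N [mN _] NE] := @formula_to_network R S false 0 phi; first by [].
by exists N => // Dv _; rewrite NE //; exact: phiP.
Qed.

Variable B : nat.

Lemma connected_simple_mean_dhn_ge_rhml :
  at_least_as_expressive (@connected_simple_mean_dhn_expr R S (degree_le S B))
                         (@connected_rhml_expr S (degree_le S B)).
Proof.
move=> P [phi con phiP].
have [|N [mN sN] NE] := @formula_to_network R S true B phi; first by [].
have [cN siN] := sN isT.
by exists N => // Dv degDv; rewrite NE //; exact: phiP.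
Qed.

Lemma connected_mean_dhn_ge_simple :
  at_least_as_expressive (@connected_mean_dhn_expr R S (degree_le S B))
                         (@connected_simple_mean_dhn_expr R S (degree_le S B)).
Proof. by move=> P [N [mN cN _] NP]; exists N. Qed.

Lemma connected_rhml_ge_mean_dhn :
  (exists r : S, (0 < arity r)%N) ->
  at_least_as_expressive (@connected_rhml_expr S (degree_le S B))
                         (@connected_mean_dhn_expr R S (degree_le S B)).
Proof.
move=> ex_r P [N [mN cN] NP].
have def := definable_network mN cN (definable_const S B (0 : 'rV[R]_0)).
have [phi con phiE] := definable_formula ex_r def.
exists phi => // -[D v] degD; rewrite -NP //.
by rewrite /rhml_accepts phiE.
Qed.

(** With a symbol of positive arity, the simple network is obtained by way of a connected
    formula. *)
Lemma connected_simple_mean_dhn_ge_mean :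
  at_least_as_expressive (@connected_simple_mean_dhn_expr R S (degree_le S B))
                         (@connected_mean_dhn_expr R S (degree_le S B)).
Proof.
move=> P exprP; have [ex_r|no_r] := pselect (exists r : S, (0 < arity r)%N).
  exact/connected_simple_mean_dhn_ge_rhml/connected_rhml_ge_mean_dhn.
(* Without symbols of positive arity no value occurs in a database. *)
pose L : layer R S 0 1 := @Layer R S 0 1 0 (fun=> 1%N)
  (fun i : 'I_0 => False_rect _ (notF (valP i)))
  (fun=> map_mx (@relu_star R) (0 + map_mx ratr 0)).
exists (LastLayer L (fun x => ratr 0 < x 0 ord0)).
  split; split=> //; try by case.
    by split; [exists (fun=> 0), 0 => x; rewrite big_ord0|case].
  by exists ord0, 0; left.
move=> -[D v]; case: no_r; have /mem_adom[[r t] _] := valP v.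
by rewrite /args /= => /tnthP[i _]; exists r; apply: leq_trans (ltn_ord i).
Qed.

End Comparison.

Theorem theorem10 (R : realType) (S : schema) :
  at_least_as_expressive (@mean_dhn_expr R S (any_db S))
                         (@rhml_expr S (any_db S))
  /\
  (forall B : nat,
     same_expressive_power
       (@connected_mean_dhn_expr R S (degree_le S B))
       (@connected_simple_mean_dhn_expr R S (degree_le S B))
     /\
     ((exists r : S, (0 < arity r)%N) ->
        same_expressive_power
          (@connected_mean_dhn_expr R S (degree_le S B))
          (@connected_rhml_expr S (degree_le S B))
        /\
        same_expressive_power
          (@connected_simple_mean_dhn_expr R S (degree_le S B))
          (@connected_rhml_expr S (degree_le S B)))).
Proof.
split; first exact: mean_dhn_ge_rhml.
move=> B.
have simple_mean := @connected_simple_mean_dhn_ge_mean R S B.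
have mean_simple := @connected_mean_dhn_ge_simple R S B.
have simple_rhml := @connected_simple_mean_dhn_ge_rhml R S B.
split=> [|/(@connected_rhml_ge_mean_dhn R S B) rhml_mean]; first by split.
split; split=> P.
- by move=> /simple_rhml/mean_simple.
- exact: rhml_mean.
- exact: simple_rhml.
- by move=> /mean_simple/rhml_mean.
Qed.
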